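(* Let $G$ be a finite group and let $S$ be a symmetric sequence of $G$-sets whose levels $S_n$ are $\Sigma_n$-free and such that $S_0^G\neq\varnothing$ and $S_2^G\neq\varnothing$. Then the free operad $\mathbb{F}(S)$ is $\Sigma$-free with $\mathbb{F}(S)(n)^G\neq\varnothing$ for every $n\geq0$, and the class of admissible sets of $\mathbb{F}(S)$ equals the indexing system generated by the class of admissible sets of $S$.
   Context: A symmetric sequence of $G$-sets is a sequence $(S_n)_{n\geq0}$ with $S_n$ a $G\times\Sigma_n$-set; $\mathbb{F}$ is the free operad functor to operads in $G$-sets. For a finite $H$-set $T$ ($H\subseteq G$) with chosen ordering $\{1,\dots,n\}\cong T$, let $\sigma:H\to\Sigma_n$ be the permutation representation and $\Gamma_T=\{(h,\sigma(h))\}\subseteq G\times\Sigma_n$. $T$ is an admissible set of a symmetric sequence (or operad) $X$ if $X(n)^{\Gamma_T}\neq\varnothing$ (independent of the ordering). An indexing system (Blumberg–Hill) is a family of finite $H$-sets, for all $H\subseteq G$, containing the trivial actions and closed under isomorphism, restriction, conjugation, subobjects, finite coproducts and products, and self-induction; the indexing system generated by a class is the smallest one containing it. *)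

(* Defs.v *)
From mathcomp Require Import all_boot all_fingroup.
Set Implicit Arguments. Unset Strict Implicit. Unset Printing Implicit Defensive.
Local Open Scope group_scope.

(* Conventions.  The finite group G is the whole finGroupType gT; subgroups *)
(* H of G are {group gT}.  Sigma_n is 'S_n = {perm 'I_n}.  NOTE: mathcomp's *)
(* product on permutations is (s * t) x = t (s x); all left-action-of       *)
(* Sigma_n statements below are with respect to functional composition,    *)
(* i.e. the composite sigma-after-tau is written (tau * sigma)%g.          *)

Definition is_symseq (gT : finGroupType) (S : nat -> Type)
  (actS : forall n, gT -> 'S_n -> S n -> S n) : Prop :=
  (forall n (s : S n), actS n 1 1 s = s) /\
  (forall n (g g' : gT) (sigma tau : 'S_n) (s : S n),
      actS n (g * g') (tau * sigma) s = actS n g sigma (actS n g' tau s)).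

Definition sigma_free (gT : finGroupType) n (X : Type)
  (act : gT -> 'S_n -> X -> X) : Prop :=
  forall (sigma : 'S_n) (x : X), act 1 sigma x = x -> sigma = 1.

(* A finite H-set: a finType X with a map a : gT -> X -> X that is an action *)
(* of H (values outside H are irrelevant). *)
Definition hset_ok (gT : finGroupType) (H : {set gT}) (X : Type)
  (a : gT -> X -> X) : Prop :=
  (forall x, a 1 x = x) /\
  (forall h h', h \in H -> h' \in H -> forall x, a (h * h') x = a h (a h' x)).

Definition mkperm (T : finType) (f : T -> T) : {perm T} :=
  match @injectiveP T T f with
  | ReflectT inj => perm inj
  | ReflectF _ => 1
  end.

Definition sigma_of (gT : finGroupType) (X : finType) (a : gT -> X -> X)
  (h : gT) : 'S_#|X| :=
  mkperm (fun i : 'I_#|X| => enum_rank (a h (enum_val i))).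

Definition hclass (gT : finGroupType) :=
  forall (H : {group gT}) (X : finType), (gT -> X -> X) -> Prop.

Definition is_coset_space (gT : finGroupType) (H K : {set gT}) (Z : finType)
  (c : gT -> Z -> Z) : Prop :=
  exists z : Z, (forall y, exists2 h, h \in H & y = c h z) /\
                (forall h, h \in H -> (c h z = z <-> h \in K)).

(* (Y,b) is (isomorphic to) the induced H-set H x_K (X,a), via j : x |-> [1,x] *)
Definition is_induced (gT : finGroupType) (H K : {set gT}) (X : finType)
  (a : gT -> X -> X) (Y : finType) (b : gT -> Y -> Y) : Prop :=
  exists j : X -> Y,
    (forall k x, k \in K -> j (a k x) = b k (j x)) /\
    (forall y, exists h x, h \in H /\ y = b h (j x)) /\
    (forall h h' x x', h \in H -> h' \in H ->
       (b h (j x) = b h' (j x') <-> exists2 k, k \in K & h = h' * k /\ x' = a k x)).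

Definition sum_act (gT : finGroupType) (X Y : Type) (a : gT -> X -> X)
  (b : gT -> Y -> Y) : gT -> (X + Y)%type -> (X + Y)%type :=
  fun h z => match z with inl x => inl (a h x) | inr y => inr (b h y) end.

Definition prod_act (gT : finGroupType) (X Y : Type) (a : gT -> X -> X)
  (b : gT -> Y -> Y) : gT -> (X * Y)%type -> (X * Y)%type :=
  fun h p => (a h p.1, b h p.2).

Definition is_indexing_system (gT : finGroupType) (I : hclass gT) : Prop :=
  (forall (H : {group gT}) (X : finType), I H X (fun _ x => x)) /\
  (forall (H : {group gT}) (X Y : finType) (a : gT -> X -> X) (b : gT -> Y -> Y)
          (f : Y -> X),
     hset_ok H a -> hset_ok H b -> bijective f ->
     (forall h y, h \in H -> f (b h y) = a h (f y)) ->
     I H X a -> I H Y b) /\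
  (forall (H K : {group gT}) (X : finType) (a : gT -> X -> X),
     K \subset H -> hset_ok H a -> I H X a -> I K X a) /\
  (* closed under conjugation: g.T is an H^g-set (H^g = g^-1 H g) *)
  (forall (H : {group gT}) (X : finType) (a : gT -> X -> X) (g : gT),
     hset_ok H a -> I H X a -> I (H :^ g)%G X (fun x => a (x ^ g^-1))) /\
  (forall (H : {group gT}) (X Y : finType) (a : gT -> X -> X) (b : gT -> Y -> Y)
          (f : Y -> X),
     hset_ok H a -> hset_ok H b -> injective f ->
     (forall h y, h \in H -> f (b h y) = a h (f y)) ->
     I H X a -> I H Y b) /\
  (forall (H : {group gT}) (X Y : finType) (a : gT -> X -> X) (b : gT -> Y -> Y),
     hset_ok H a -> hset_ok H b -> I H X a -> I H Y b ->
     I H (X + Y)%type (sum_act a b)) /\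
  (forall (H : {group gT}) (X Y : finType) (a : gT -> X -> X) (b : gT -> Y -> Y),
     hset_ok H a -> hset_ok H b -> I H X a -> I H Y b ->
     I H (X * Y)%type (prod_act a b)) /\
  (forall (H K : {group gT}) (Z : finType) (c : gT -> Z -> Z)
          (X : finType) (a : gT -> X -> X) (Y : finType) (b : gT -> Y -> Y),
     K \subset H -> hset_ok H c -> hset_ok K a -> hset_ok H b ->
     is_coset_space H K c -> I H Z c -> I K X a ->
     is_induced H K a b -> I H Y b).

Definition gen_indexing (gT : finGroupType) (C : hclass gT) : hclass gT :=
  fun H X a => forall I : hclass gT, is_indexing_system I ->
    (forall H' X' a', C H' X' a' -> I H' X' a') -> I H X a.

Definition adm_symseq (gT : finGroupType) (S : nat -> Type)
  (actS : forall n, gT -> 'S_n -> S n -> S n) : hclass gT :=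
  fun H X a => exists s : S #|X|,
    forall h, h \in H -> actS #|X| h (sigma_of a h) s = s.

(* Trees: a leaf labelled by a natural number, or a vertex decorated by     *)
(* s : S k with an ordered list of k subtrees (subtree i plugged in input i). *)
Inductive tree (S : nat -> Type) : Type :=
| Leaf : nat -> tree S
| Node : forall k : nat, S k -> seq (tree S) -> tree S.
Arguments Leaf {S}.
Arguments Node {S} k.

Section FreeOperad.
Variables (gT : finGroupType) (S : nat -> Type)
          (actS : forall n, gT -> 'S_n -> S n -> S n).

Fixpoint wf_tree (t : tree S) : bool :=
  match t with
  | Leaf _ => true
  | Node k _ ts => (size ts == k) && all wf_tree ts
  end.

Fixpoint leaves (t : tree S) : seq nat :=
  match t with
  | Leaf i => [:: i]
  | Node _ _ ts => flatten (map leaves ts)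
  end.

(* representatives of F(S)(n): leaves labelled bijectively by 0..n-1 *)
Definition inF (n : nat) (t : tree S) : Prop :=
  wf_tree t /\ perm_eq (leaves t) (iota 0 n).

Fixpoint gact (g : gT) (t : tree S) : tree S :=
  match t with
  | Leaf i => Leaf i
  | Node k s ts => Node k (@actS k g 1 s) (map (gact g) ts)
  end.

Definition permf n (sigma : 'S_n) (i : nat) : nat :=
  match (insub i : option 'I_n) with
  | Some j => nat_of_ord (sigma j)
  | None => i
  end.

Fixpoint relabel (f : nat -> nat) (t : tree S) : tree S :=
  match t with
  | Leaf i => Leaf (f i)
  | Node k s ts => Node k s (map (relabel f) ts)
  end.

Definition sact n (sigma : 'S_n) (t : tree S) : tree S := relabel (permf sigma) t.

Definition permute k (sigma : 'S_k) (ts : seq (tree S)) : seq (tree S) :=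
  [seq nth (Leaf 0) ts (sigma i) | i <- enum 'I_k].

Inductive tequiv : tree S -> tree S -> Prop :=
| teq_refl t : tequiv t t
| teq_sym t u : tequiv t u -> tequiv u t
| teq_trans t u v : tequiv t u -> tequiv u v -> tequiv t v
| teq_vertex k (sigma : 'S_k) (s : S k) ts : size ts = k ->
    tequiv (Node k (@actS k 1 sigma s) ts) (Node k s (permute sigma ts))
| teq_cong k (s : S k) ts ts' : size ts = size ts' ->
    (forall i, i < size ts -> tequiv (nth (Leaf 0) ts i) (nth (Leaf 0) ts' i)) ->
    tequiv (Node k s ts) (Node k s ts').

Definition FS_sigma_free : Prop :=
  forall n (t : tree S) (sigma : 'S_n), inF n t -> tequiv (sact sigma t) t -> sigma = 1.

Definition FS_G_fixed_nonempty (n : nat) : Prop :=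
  exists t, inF n t /\ forall g : gT, tequiv (gact g t) t.

Definition adm_FS : hclass gT :=
  fun H X a => exists t, inF #|X| t /\
    forall h, h \in H -> tequiv (sact (sigma_of a h) (gact h t)) t.

End FreeOperad.

(* Main.v *)
Require Import Defs.
From Stdlib Require Eqdep_dec.
From mathcomp Require Import all_boot all_fingroup.
Set Implicit Arguments. Unset Strict Implicit. Unset Printing Implicit Defensive.
Local Open Scope group_scope.

(* Equivalent trees have the same root up to a permutation sigma of its
   inputs, and sigma is unique because the levels of S are free; peeling off
   roots gives Sigma-freeness of F(S).
   Admissible sets of F(S) form an indexing system because every closure
   property is an instance of grafting: if t witnesses the H-set X, and
   phi x (x in X) is a family of trees permuted by H like X itself, then
   grafting phi x onto the leaf x of t witnesses the H-set of all the leaves of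
   the phi x.  Nullary vertices prune leaves (subobjects), binary ones give sums.
   Conversely, let t with root s in S(k) witness X.  The permutations sigma
   make {1..k} an H-set witnessed by s, and X maps equivariantly to it, the
   fibre over i being witnessed over the stabilizer of i by the i-th subtree.
   So X is a sum, over the orbits of {1..k}, of sets induced from these fibres,
   and induction on t applies. *)

(** For a tree with distinct leaf labels, this makes the child of the root that carries a given
    label unique. *)
Lemma uniq_flatten_nth (T : eqType) (ss : seq (seq T)) i j x :
  uniq (flatten ss) -> x \in nth [::] ss i -> x \in nth [::] ss j -> i = j.
Proof.
have nth_flat (rs : seq (seq T)) m : x \in nth [::] rs m -> x \in flatten rs.
  case: (ltnP m (size rs)) => [lt_m xm|le_m]; last by rewrite nth_default.
  by apply/flattenP; exists (nth [::] rs m); rewrite ?mem_nth.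
elim: ss i j => [|s ss IHss] [|i] [|j] //=; rewrite cat_uniq.
- case/and3P=> _ /hasPn disj _ xs /nth_flat xss.
  by have /= := disj _ xss; rewrite xs.
- case/and3P=> _ /hasPn disj _ /nth_flat xss xs.
  by have /= := disj _ xss; rewrite xs.
- by case/and3P=> _ _ uss xi xj; rewrite (IHss i j).
Qed.

(** * Trees: induction, grafting, relabelling and leaves *)

Section Trees.
Variable S : nat -> Type.
Implicit Types (t u : tree S) (ts us : seq (tree S)) (f g : nat -> nat).

Local Notation nth_tree := (nth (Leaf (S:=S) 0)).

(** Subtrees are nested in a list, so the induction hypothesis has to be supplied by hand; indexing
    by [nth] matches the form of [teq_cong]. *)
Lemma tree_nth_ind (P : tree S -> Prop) :
  (forall i, P (Leaf i)) ->
  (forall k (s : S k) ts,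
     (forall i, i < size ts -> P (nth_tree ts i)) -> P (Node k s ts)) ->
  forall t, P t.
Proof.
move=> PL PN; fix IH 1 => -[i|k s ts]; first exact: PL.
apply: PN; elim: ts => [|t ts IHts] [|i] lt_i.
(* Without [clear], automation could close this goal by an unguarded use of [IH]. *)
- by clear IH.
- by clear IH.
- exact: IH.
- exact: (IHts i lt_i).
Qed.

Lemma eq_map_nth (R : Type) (F F' : tree S -> R) ts :
  (forall i, i < size ts -> F (nth_tree ts i) = F' (nth_tree ts i)) ->
  map F ts = map F' ts.
Proof.
elim: ts => //= t ts IHts FF'; congr (_ :: _); first exact: (FF' 0).
by apply: IHts => i; apply: (FF' i.+1).
Qed.

Lemma leaves_nth ts i x :
  i < size ts -> x \in leaves (nth_tree ts i) -> x \in flatten (map (@leaves S) ts).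
Proof.
move=> lt_i x_i; apply/flattenP; exists (leaves (nth_tree ts i)) => //.
by apply/(nthP [::]); exists i; rewrite ?size_map ?(nth_map (Leaf 0)).
Qed.

Lemma mem_leaves_nth ts x :
  x \in flatten (map (@leaves S) ts) ->
  exists2 i, i < size ts & x \in leaves (nth_tree ts i).
Proof.
case/flattenP=> s /(nthP [::])[i]; rewrite size_map => lt_i <-.
by rewrite (nth_map (Leaf 0)) //; exists i.
Qed.

Lemma wf_nth k (s : S k) ts i :
  wf_tree (Node k s ts) -> i < size ts -> wf_tree (nth_tree ts i).
Proof. by case/andP=> _ /all_nthP wf_ts /wf_ts. Qed.

Lemma wf_NodeP k (s : S k) ts :
  size ts = k -> (forall i, i < size ts -> wf_tree (nth_tree ts i)) ->
  wf_tree (Node k s ts).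
Proof.
by move=> sz wf_ts /=; rewrite sz eqxx; apply/(all_nthP (Leaf 0)).
Qed.

(* Simultaneous operadic composition. *)
Fixpoint graft (phi : nat -> tree S) t : tree S :=
  match t with
  | Leaf i => phi i
  | Node k s ts => Node k s (map (graft phi) ts)
  end.

Lemma eq_graft phi psi t :
  {in leaves t, phi =1 psi} -> graft phi t = graft psi t.
Proof.
elim/tree_nth_ind: t => [i|k s ts IHt] eq_phi /=.
  by apply: eq_phi; rewrite inE.
congr Node; apply: eq_map_nth => i lt_i; apply: IHt => // x x_i.
exact/eq_phi/(leaves_nth lt_i).
Qed.

Lemma relabel_graft f t : relabel f t = graft (fun i => Leaf (f i)) t.
Proof.
elim/tree_nth_ind: t => [i|k s ts IHt] //=.
by congr Node; apply: eq_map_nth.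
Qed.

Lemma graft_graft phi psi t :
  graft phi (graft psi t) = graft (fun i => graft phi (psi i)) t.
Proof.
elim/tree_nth_ind: t => [i|k s ts IHt] //=.
by rewrite -map_comp; congr Node; apply: eq_map_nth => i /IHt.
Qed.

Lemma relabel_relabel f g t : relabel f (relabel g t) = relabel (f \o g) t.
Proof. by rewrite !relabel_graft graft_graft. Qed.

Lemma eq_relabel f g t : {in leaves t, f =1 g} -> relabel f t = relabel g t.
Proof.
by move=> fg; rewrite !relabel_graft; apply: eq_graft => i /fg->.
Qed.

Lemma relabel_id t : relabel id t = t.
Proof.
elim/tree_nth_ind: t => [i|k s ts IHt] //=; congr Node.
by rewrite -[RHS]map_id; apply: eq_map_nth.
Qed.

Lemma leaves_graft phi t :
  leaves (graft phi t) = flatten [seq leaves (phi i) | i <- leaves t].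
Proof.
elim/tree_nth_ind: t => [i|k s ts IHt] /=; first by rewrite cats0.
rewrite -map_comp.
transitivity (flatten [seq flatten [seq leaves (phi i) | i <- leaves t] | t <- ts]).
  by congr flatten; apply: eq_map_nth.
by elim: ts {IHt} => //= t ts ->; rewrite map_cat flatten_cat.
Qed.

Lemma leaves_relabel f t : leaves (relabel f t) = map f (leaves t).
Proof.
rewrite relabel_graft leaves_graft.
by elim: (leaves t) => //= x s ->.
Qed.

Lemma wf_graft phi t :
  wf_tree t -> {in leaves t, forall i, wf_tree (phi i)} -> wf_tree (graft phi t).
Proof.
elim/tree_nth_ind: t => [i|k s ts IHt] wf_t wf_phi.
  by apply: wf_phi; rewrite inE.
apply: wf_NodeP => [|i]; rewrite size_map; first by case/andP: wf_t => /eqP.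
move=> lt_i; rewrite (nth_map (Leaf 0)) //.
apply: IHt => // [|x x_i]; first exact: wf_nth wf_t lt_i.
exact/wf_phi/(leaves_nth lt_i).
Qed.

Lemma wf_relabel f t : wf_tree t -> wf_tree (relabel f t).
Proof. by move=> wf_t; rewrite relabel_graft; apply: wf_graft. Qed.

Lemma size_permute k (sigma : 'S_k) ts : size (permute sigma ts) = k.
Proof. by rewrite size_map size_enum_ord. Qed.

Lemma nth_permute k (sigma : 'S_k) ts (i : 'I_k) :
  nth_tree (permute sigma ts) i = nth_tree ts (sigma i).
Proof. by rewrite (nth_map i) ?size_enum_ord ?nth_ord_enum. Qed.

Lemma map_permute k (sigma : 'S_k) (F : tree S -> tree S) ts :
  size ts = k -> map F (permute sigma ts) = permute sigma (map F ts).
Proof.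
move=> sz; rewrite -map_comp; apply: eq_map => i /=.
by rewrite (nth_map (Leaf 0)) ?sz.
Qed.

(** Both lists come from the same function on ['I_k], applied to two enumerations that differ by the
    bijection [sigma]. *)
Lemma perm_leaves_permute k (sigma : 'S_k) ts : size ts = k ->
  perm_eq (map (@leaves S) (permute sigma ts)) (map (@leaves S) ts).
Proof.
move=> sz; pose L (i : 'I_k) := leaves (nth_tree ts i).
have ->: map (@leaves S) (permute sigma ts) = map L (map sigma (enum 'I_k)).
  by rewrite -!map_comp.
have ->: map (@leaves S) ts = map L (enum 'I_k).
  apply: (@eq_from_nth _ [::]) => [|i].
    by rewrite size_map [RHS]size_map size_enum_ord.
  rewrite size_map => lt_i; have lt_ik: i < k by rewrite -sz.
  rewrite (nth_map (Leaf 0)) // (nth_map (Ordinal lt_ik)) ?size_enum_ord //.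
  by rewrite /L nth_enum_ord.
apply/perm_map/uniq_perm; rewrite ?(map_inj_uniq perm_inj) ?enum_uniq //.
move=> i; rewrite mem_enum; apply/mapP; exists (sigma^-1 i); rewrite ?mem_enum //.
by rewrite permKV.
Qed.

End Trees.

(** * Equivalence of trees, its inversion at the root, and $\Sigma$-freeness *)

Section Equivalence.
Variables (gT : finGroupType) (S : nat -> Type)
          (actS : forall n, gT -> 'S_n -> S n -> S n).
Arguments actS : clear implicits.
Hypothesis HS : is_symseq actS.
Hypothesis Hfree : forall n, sigma_free (actS n).
Implicit Types (t u : tree S) (ts us : seq (tree S)) (f : nat -> nat).

Local Notation nth_tree := (nth (Leaf (S:=S) 0)).
Local Notation "t ~~ u" := (tequiv actS t u) (at level 70).
Local Notation "g *: t" := (Defs.gact actS g t).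

Lemma actS1 n s : actS n 1 1 s = s. Proof. exact: (proj1 HS). Qed.

Lemma actSM n g g' (sigma tau : 'S_n) s :
  actS n (g * g') (tau * sigma) s = actS n g sigma (actS n g' tau s).
Proof. exact: (proj2 HS). Qed.

(** Two permutations that fix [s] together with the same [g] differ by an element of $\Sigma_n$
    fixing [s], which is trivial by freeness. Hence the stabilizer of [s] is the graph of a
    homomorphism on a subgroup of $G$. *)
Lemma actS_inj_perm n g (sigma tau : 'S_n) s :
  actS n g sigma s = s -> actS n g tau s = s -> sigma = tau.
Proof.
move=> fix_sigma fix_tau; apply/eqP; rewrite eq_mulgV1; apply/eqP.
apply: (Hfree (x := s)); rewrite -(mulVg g) actSM fix_sigma.
by rewrite -[in LHS]fix_tau -actSM mulVg mulgV actS1.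
Qed.

Lemma gact_treeM g h t : (g * h) *: t = g *: (h *: t).
Proof.
elim/tree_nth_ind: t => [i|k s ts IHt] //=; rewrite -actSM mulg1 -map_comp.
by congr Node; apply: eq_map_nth.
Qed.

Lemma gact_graft g phi t :
  g *: (graft phi t) = graft (fun i => g *: (phi i)) (g *: t).
Proof.
elim/tree_nth_ind: t => [i|k s ts IHt] //=; rewrite -!map_comp.
by congr Node; apply: eq_map_nth.
Qed.

Lemma gact_relabel g f t : g *: (relabel f t) = relabel f (g *: t).
Proof. by rewrite !relabel_graft gact_graft. Qed.

Lemma leaves_gact g t : leaves (g *: t) = leaves t.
Proof.
elim/tree_nth_ind: t => [i|k s ts IHt] //=.
by rewrite -map_comp; congr flatten; apply: eq_map_nth.
Qed.

Lemma wf_gact g t : wf_tree t -> wf_tree (g *: t).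
Proof.
elim/tree_nth_ind: t => [i|k s ts IHt] wf_t //.
apply: wf_NodeP => [|i]; rewrite size_map; first by case/andP: wf_t => /eqP.
move=> lt_i; rewrite (nth_map (Leaf 0)) //; apply: IHt => //.
exact: wf_nth wf_t lt_i.
Qed.

Lemma tequiv_wf t u : t ~~ u -> wf_tree t = wf_tree u.
Proof.
elim=> {t u} // [t u v _ -> _ -> //|k sigma s ts sz|k s ts us sz _ IH] /=.
  rewrite size_permute sz eqxx /=; apply/(all_nthP (Leaf 0))/(all_nthP (Leaf 0)).
    move=> wf_ts i; rewrite size_permute => lt_i.
    by rewrite (nth_permute sigma ts (Ordinal lt_i)); apply: wf_ts; rewrite sz.
  move=> wf_ts i; rewrite sz => lt_i; have := wf_ts (sigma^-1 (Ordinal lt_i)).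
  by rewrite size_permute nth_permute permKV; apply.
rewrite sz; congr (_ && _).
apply/(all_nthP (Leaf 0))/(all_nthP (Leaf 0)) => wf_ts i lt_i.
  by rewrite -IH ?wf_ts // sz.
by rewrite IH ?wf_ts // -sz.
Qed.

Lemma tequiv_leaves t u : t ~~ u -> perm_eq (leaves t) (leaves u).
Proof.
elim=> {t u} // [t u _|t u v _ tu _ uv|k sigma s ts sz|k s ts us sz _ IH] /=.
- by rewrite perm_sym.
- exact: perm_trans tu uv.
- by rewrite perm_sym; apply/perm_flatten/perm_leaves_permute.
apply/seq.permP => P; rewrite !count_flatten; congr sumn.
apply: (@eq_from_nth _ 0); rewrite !size_map // => i lt_i.
rewrite -!map_comp !(nth_map (Leaf 0)) -?sz //=.
exact/seq.permP/IH.
Qed.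

Lemma tequiv_gact g t u : t ~~ u -> g *: t ~~ g *: u.
Proof.
elim=> {t u} /= [t|t u _|t u v _ tu _|k sigma s ts sz|k s ts us sz _ IH].
- exact: teq_refl.
- exact: teq_sym.
- exact: teq_trans.
- rewrite map_permute // -actSM !mulg1.
  have ->: actS k g sigma s = actS k 1 sigma (actS k g 1 s).
    by rewrite -actSM !mul1g.
  by apply: teq_vertex; rewrite size_map.
apply: teq_cong => [|i]; rewrite !size_map // => lt_i.
by rewrite !(nth_map (Leaf 0)) -?sz //; apply: IH.
Qed.

Lemma tequiv_graft phi t u : t ~~ u -> graft phi t ~~ graft phi u.
Proof.
elim=> {t u} /= [t|t u _|t u v _ tu _|k sigma s ts sz|k s ts us sz _ IH].
- exact: teq_refl.
- exact: teq_sym.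
- exact: teq_trans.
- by rewrite map_permute //; apply: teq_vertex; rewrite size_map.
apply: teq_cong => [|i]; rewrite !size_map // => lt_i.
by rewrite !(nth_map (Leaf 0)) -?sz //; apply: IH.
Qed.

Lemma tequiv_relabel f t u : t ~~ u -> relabel f t ~~ relabel f u.
Proof. by rewrite !relabel_graft; apply: tequiv_graft. Qed.

Lemma tequiv_graft_fun phi psi t :
  {in leaves t, forall i, phi i ~~ psi i} -> graft phi t ~~ graft psi t.
Proof.
elim/tree_nth_ind: t => [i|k s ts IHt] equiv_phi /=.
  by apply: equiv_phi; rewrite inE.
apply: teq_cong => [|i]; rewrite !size_map // => lt_i.
rewrite !(nth_map (Leaf 0)) //; apply: IHt => // x x_i.
exact/equiv_phi/(leaves_nth lt_i).
Qed.

(** Symmetry and transitivity are constructors of [tequiv], so plain case analysis reveals nothing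
    about roots. This relation allows one permutation at the root and is itself stable under
    inverses and composites. *)
Definition tequiv_inv_spec t u : Prop :=
  match t, u with
  | Leaf i, Leaf j => i = j
  | Leaf _, Node _ _ _ => False
  | Node k s ts, _ => exists (sigma : 'S_k) us,
      [/\ u = Node k (actS k 1 sigma s) us, size us = k
        & forall i : 'I_k, nth_tree ts i ~~ nth_tree us (sigma i)]
  end.

Lemma tequiv_inv t u : t ~~ u -> wf_tree t -> tequiv_inv_spec t u.
Proof.
elim=> {t u} [[i|k s ts]|t u tu IH|t u v tu IHtu uv IHuv|k sigma s ts sz
             |k s ts us sz tsus IH] //.
- case/andP=> /eqP sz _; exists 1, ts; rewrite actS1; split=> // i.
  by rewrite perm1; apply: teq_refl.
- move=> wf_u; have wf_t: wf_tree t by rewrite (tequiv_wf tu).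
  have := IH wf_t; case: t wf_t {tu IH} => [i|k s ts] wf_t.
    by case: u wf_u => //= j _ ->.
  case=> sigma [us [-> sz tsus]]; exists (sigma^-1), ts; split.
  + by rewrite -actSM mulg1 mulgV actS1.
  + by case/andP: wf_t => /eqP.
  by move=> i; apply: teq_sym; rewrite -{2}(permKV sigma i).
- move=> wf_t; have wf_u: wf_tree u by rewrite -(tequiv_wf tu).
  have := IHtu wf_t; have := IHuv wf_u; case: t wf_t {tu IHtu} => [i|k s ts] wf_t.
    by case: u wf_u {uv IHuv} => //= j _; case: v => //= l <- ->.
  move=> inv_uv [sigma [us [def_u sz tsus]]].
  move: inv_uv; rewrite def_u => -[tau [vs [-> szv usvs]]].
  exists (sigma * tau), vs; split=> // [|i]; first by rewrite -actSM mulg1.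
  by rewrite permM; apply: teq_trans (tsus i) (usvs _).
(* The left root is already twisted by [sigma], so the inverse recovers [s]. *)
- move=> _; exists (sigma^-1), (permute sigma ts).
  rewrite -actSM mulg1 mulgV actS1 size_permute; split=> // i.
  by rewrite nth_permute permKV; apply: teq_refl.
case/andP=> /eqP szk _; exists 1, us; rewrite actS1 -sz; split=> // i.
by rewrite perm1; apply: tsus; rewrite szk.
Qed.

(** Injectivity in the dependent argument [s : S k] rests on decidable equality of the arities. *)
Lemma Node_inj k (s s' : S k) ts ts' : Node k s ts = Node k s' ts' -> s = s' /\ ts = ts'.
Proof.
case=> eq_s ->; split=> //; apply: Eqdep_dec.inj_pair2_eq_dec eq_s => m n.
by case: (m =P n); [left | right].
Qed.

Lemma tequiv_Node k (s s' : S k) ts us :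
  wf_tree (Node k s ts) -> Node k s ts ~~ Node k s' us ->
  exists sigma : 'S_k, s' = actS k 1 sigma s /\
    forall i : 'I_k, nth_tree ts i ~~ nth_tree us (sigma i).
Proof.
move=> wf_t /tequiv_inv-/(_ wf_t)[sigma [us' [/Node_inj[-> ->] _ tsus]]].
by exists sigma.
Qed.

(** Relabelling keeps the root decoration, so the permutation matching the two roots fixes [s] and
    is trivial by freeness. Each subtree is then equivalent to its own relabelling, down to the
    leaves. *)
Lemma relabel_fixed f t :
  wf_tree t -> relabel f t ~~ t -> {in leaves t, forall i, f i = i}.
Proof.
elim/tree_nth_ind: t => [i|k s ts IHt] wf_t.
  by move/tequiv_inv=> /(_ isT) /= f_i j /[!inE] /eqP->.
have /eqP sz: size ts == k by case/andP: wf_t.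
move=> /(tequiv_Node (wf_relabel f wf_t))[sigma [/esym/Hfree-> tsts]] x.
case/mem_leaves_nth=> i lt_i; apply: IHt => //; first exact: wf_nth wf_t lt_i.
have lt_ik: i < k by rewrite -sz.
by have := tsts (Ordinal lt_ik); rewrite perm1 (nth_map (Leaf 0)).
Qed.

Lemma FS_sigma_freeP : FS_sigma_free actS.
Proof.
move=> n t sigma [wf_t /perm_mem lv_t] /relabel_fixed-/(_ wf_t) fix_t.
apply/permP => i; rewrite perm1; apply: val_inj => /=.
have := fix_t i; rewrite lv_t mem_iota add0n ltn_ord /= => /(_ isT).
by rewrite /permf valK.
Qed.

End Equivalence.

(** * Finite actions and the numbering of finite sets *)

Section FiniteActions.
Variables (gT : finGroupType) (H : {group gT}) (X : finType) (a : gT -> X -> X).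
Hypothesis aP : hset_ok H a.

Lemma hact1 x : a 1 x = x. Proof. exact: (proj1 aP). Qed.

Lemma hactM h h' x : h \in H -> h' \in H -> a (h * h') x = a h (a h' x).
Proof. by move=> Hh Hh'; apply: (proj2 aP). Qed.

Lemma hactK h : h \in H -> cancel (a h) (a h^-1).
Proof. by move=> Hh x; rewrite -hactM ?groupV // mulVg hact1. Qed.

Lemma hactKV h : h \in H -> cancel (a h^-1) (a h).
Proof. by move=> Hh x; rewrite -hactM ?groupV // mulgV hact1. Qed.

(** The default value of [mkperm] is excluded, since [a h] is invertible for [h] in [H]. *)
Lemma sigma_ofE h i : h \in H -> sigma_of a h i = enum_rank (a h (enum_val i)).
Proof.
move=> Hh; rewrite /sigma_of /mkperm; case: injectiveP => [inj|]; first by rewrite permE.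
by case=> i1 i2 /enum_rank_inj /(can_inj (hactK Hh)) /enum_val_inj.
Qed.

End FiniteActions.

Section Codes.
Implicit Types X Y Z : finType.

Definition code X (x : X) : nat := enum_rank x.

Lemma code_inj X : injective (@code X).
Proof. by move=> x y /ord_inj /enum_rank_inj. Qed.

Lemma insub_code X (x : X) : insub (code x) = Some (enum_rank x).
Proof. exact: valK. Qed.

(** This carries a map of finite sets to leaf labels. The identity beyond [#|X|] is also the default
    of [permf], so the two agree on all numbers. *)
Definition lab X Y (f : X -> Y) (n : nat) : nat :=
  if insub n : option 'I_#|X| is Some i then code (f (enum_val i)) else n.

Lemma lab_code X Y (f : X -> Y) x : lab f (code x) = code (f x).
Proof. by rewrite /lab insub_code enum_rankK. Qed.

Definition codes X : seq nat := [seq code x | x <- enum X].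

Lemma perm_codes X : perm_eq (iota 0 #|X|) (codes X).
Proof.
apply: uniq_perm; rewrite ?iota_uniq ?(map_inj_uniq (@code_inj X)) ?enum_uniq //.
move=> n; rewrite mem_iota add0n; apply/idP/mapP => [/= lt_n|[x _ ->]].
  by exists (enum_val (Ordinal lt_n)); rewrite ?mem_enum // /code enum_valK.
by rewrite ltn_ord.
Qed.

Lemma permf_sigma_of (gT : finGroupType) (H : {group gT}) X (a : gT -> X -> X) h :
  hset_ok H a -> h \in H -> permf (sigma_of a h) =1 lab (a h).
Proof.
move=> aP Hh n; rewrite /permf /lab; case: insubP => // i _ _.
by rewrite (sigma_ofE aP).
Qed.

(** Induction splits off the fibre over the first point. It is used to count the leaves of a grafted
    tree fibre by fibre. *)
Lemma perm_flatten_fibres (T U : eqType) (pi : T -> U) (xs : seq U) (s : seq T) :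
  uniq xs ->
  perm_eq (flatten [seq [seq y <- s | pi y == x] | x <- xs])
          [seq y <- s | pi y \in xs].
Proof.
elim: xs => [|x xs IHxs] /=; first by rewrite filter_pred0.
case/andP=> xs'x /IHxs uxs.
set s1 := [seq y <- s | pi y \in x :: xs].
rewrite perm_sym -(permPl (permEl (perm_filterC (fun y => pi y == x) s1))) perm_sym.
rewrite -!filter_predI perm_cat //.
  rewrite (@eq_filter _ _ (predI (fun y => pi y == x) (fun y => pi y \in x :: xs))) //.
  by move=> y /=; rewrite inE; case: eqP.
rewrite (@eq_filter _ (predI _ _) (fun y => pi y \in xs)) // => y /=.
by rewrite inE; case: eqP => //= ->; rewrite (negPf xs'x).
Qed.

Lemma perm_codom_enum X Y (j : X -> Y) (P : pred Y) :
  injective j -> (forall y, P y = (y \in codom j)) ->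
  perm_eq (map j (enum X)) [seq y <- enum Y | P y].
Proof.
move=> j_inj defP; apply: uniq_perm.
- by rewrite (map_inj_uniq j_inj) enum_uniq.
- by rewrite filter_uniq ?enum_uniq.
by move=> y; rewrite mem_filter mem_enum andbT defP.
Qed.

End Codes.

(** * Admissible sets of the free operad form an indexing system containing those of [S] *)

Section Admissible.
Variables (gT : finGroupType) (S : nat -> Type)
          (actS : forall n, gT -> 'S_n -> S n -> S n).
Arguments actS : clear implicits.
Hypothesis HS : is_symseq actS.
Implicit Types (t u : tree S) (H K : {group gT}) (X Y Z : finType).

Local Notation "t ~~ u" := (tequiv actS t u) (at level 70).
Local Notation "g *: t" := (Defs.gact actS g t).

Definition labelled X t := perm_eq (leaves t) (codes X).

Lemma labelled_code X t i : labelled X t -> i \in leaves t -> exists x : X, i = code x.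
Proof. by move/perm_mem=> -> /mapP[x _ ->]; exists x. Qed.

Lemma relabel_labM X Y Z (f : Y -> Z) (g : X -> Y) t : labelled X t ->
  relabel (lab f) (relabel (lab g) t) = relabel (lab (f \o g)) t.
Proof.
move=> lab_t; rewrite relabel_relabel; apply: eq_relabel => i.
by case/(labelled_code lab_t)=> x -> /=; rewrite !lab_code.
Qed.

Lemma eq_relabel_lab X Y (f g : X -> Y) t : labelled X t -> f =1 g ->
  relabel (lab f) t = relabel (lab g) t.
Proof.
move=> lab_t fg; apply: eq_relabel => i.
by case/(labelled_code lab_t)=> x -> /=; rewrite !lab_code fg.
Qed.

Lemma relabel_lab_id X t : labelled X t -> relabel (lab (fun x : X => x)) t = t.
Proof.
move=> lab_t; rewrite -[RHS]relabel_id; apply: eq_relabel => i.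
by case/(labelled_code lab_t)=> x ->; rewrite lab_code.
Qed.

Lemma labelled_gact X g t : labelled X (g *: t) = labelled X t.
Proof. by rewrite /labelled leaves_gact. Qed.

(** A representative of a $\Gamma_X$-fixed point of $\mathbb{F}(S)$, with leaves named by elements
    of [X], so that the action itself replaces its permutation representation. *)
Definition adm_tree H X (a : gT -> X -> X) t :=
  [/\ wf_tree t, labelled X t
    & forall h, h \in H -> relabel (lab (a h)) (h *: t) ~~ t].

Lemma adm_FSP H X (a : gT -> X -> X) : hset_ok H a ->
  adm_FS actS H a <-> exists t, adm_tree H a t.
Proof.
move=> aP; rewrite /adm_FS /inF; split=> [[t [[wf_t lv_t] fix_t]]|[t [wf_t lv_t fix_t]]].
  exists t; split=> // [|h Hh].
    exact: perm_trans lv_t (perm_codes X).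
  rewrite -(@eq_relabel _ (permf (sigma_of a h))); first exact: fix_t.
  by move=> i _; apply: permf_sigma_of aP Hh _.
exists t; split; first by split=> //; rewrite (perm_trans lv_t) // perm_sym perm_codes.
move=> h Hh; rewrite /sact (@eq_relabel _ _ (lab (a h))); first exact: fix_t.
by move=> i _; apply: permf_sigma_of aP Hh _.
Qed.

Lemma leaves_relabel_lab X Y (j : X -> Y) (P : pred Y) t :
  labelled X t -> injective j -> (forall y, P y = (y \in codom j)) ->
  perm_eq (leaves (relabel (lab j) t)) [seq code y | y <- enum Y & P y].
Proof.
move=> lab_t j_inj defP; rewrite leaves_relabel (perm_trans (perm_map _ lab_t)) //.
have ->: map (lab j) (codes X) = map (@code Y) (map j (enum X)).
  by rewrite /codes -!map_comp; apply: eq_map => x /=; rewrite lab_code.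
exact/perm_map/perm_codom_enum.
Qed.

(** The tree [phi x] carries the fibre of [pi] over [x], so grafting uses each element of [Y] once.
    Acting by [h] turns [phi x] into [phi (a h x)]; this amounts to relabelling [t] by [a h], which
    is absorbed because [t] is fixed. *)
Lemma adm_tree_graft H X Y (a : gT -> X -> X) (b : gT -> Y -> Y) t
    (phi : X -> tree S) (pi : Y -> X) :
  adm_tree H a t -> (forall x, wf_tree (phi x)) ->
  (forall x, perm_eq (leaves (phi x)) [seq code y | y <- enum Y & pi y == x]) ->
  (forall h x, h \in H -> relabel (lab (b h)) (h *: phi x) ~~ phi (a h x)) ->
  exists u, adm_tree H b u.
Proof.
move=> [wf_t lab_t fix_t] wf_phi lv_phi equiv_phi.
(* The value off the codes is immaterial: every leaf of [t] is a code. *)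
pose psi n := if insub n : option 'I_#|X| is Some i then phi (enum_val i) else Leaf n.
have psi_code x: psi (code x) = phi x by rewrite /psi insub_code enum_rankK.
exists (graft psi t); split=> [||h Hh].
- apply: wf_graft => // i /(labelled_code lab_t)[x ->].
  by rewrite psi_code.
- rewrite /labelled leaves_graft.
  apply: (@perm_trans _ (flatten [seq leaves (psi i) | i <- codes X])).
    exact/perm_flatten/perm_map.
  rewrite -map_comp; set xs := enum X.
  apply: (@perm_trans _ (flatten [seq [seq code y | y <- enum Y & pi y == x] | x <- xs])).
    elim: xs => //= x xs IHxs; rewrite psi_code perm_cat //.
  have ->: flatten [seq [seq code y | y <- enum Y & pi y == x] | x <- xs]
         = map (@code Y) (flatten [seq [seq y <- enum Y | pi y == x] | x <- xs]).
    by rewrite map_flatten -map_comp.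
  apply: perm_map; rewrite (perm_trans (perm_flatten_fibres _ _ _)) ?enum_uniq //.
  rewrite (@eq_filter _ _ predT) ?filter_predT // => y /=.
  by rewrite mem_enum.
rewrite relabel_graft gact_graft // graft_graft.
(* The motion of the grafted family is traded for a relabelling of the outer tree. *)
apply: (@teq_trans _ _ _ _ (graft (fun i => psi (lab (a h) i)) (h *: t))).
  apply: tequiv_graft_fun => i; rewrite leaves_gact.
  case/(labelled_code lab_t)=> x ->; rewrite -relabel_graft lab_code !psi_code.
  exact: equiv_phi.
have ->: graft (fun i => psi (lab (a h) i)) (h *: t)
       = graft psi (relabel (lab (a h)) (h *: t)).
  by rewrite relabel_graft graft_graft.
exact/tequiv_graft/fix_t.
Qed.

(** Leaves outside the image of [f] are capped by the fixed nullary vertex. *)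
Lemma adm_tree_sub H X Y (a : gT -> X -> X) (b : gT -> Y -> Y) (f : Y -> X) t :
  (exists s : S 0, forall g : gT, actS 0 g 1 s = s) ->
  hset_ok H a -> hset_ok H b -> injective f ->
  (forall h y, h \in H -> f (b h y) = a h (f y)) ->
  adm_tree H a t -> exists u, adm_tree H b u.
Proof.
move=> [s0 fix_s0] aP bP f_inj f_eq adm_t.
pose phi x := if [pick y | f y == x] is Some y then Leaf (code y) else Node 0 s0 [::].
have phi_f y: phi (f y) = Leaf (code y).
  rewrite /phi; case: pickP => [y' /eqP /f_inj -> //|/(_ y)].
  by rewrite eqxx.
have phi_f' x: (forall y, f y != x) -> phi x = Node 0 s0 [::].
  by move=> f'x; rewrite /phi; case: pickP => // y; rewrite (negPf (f'x y)).
have fP x: (exists y, x = f y) \/ (forall y, f y != x).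
  case: (pickP (fun y => f y == x)) => [y /eqP <-|f'x]; first by left; exists y.
  by right=> y; rewrite f'x.
apply: (adm_tree_graft (phi := phi) (pi := f) adm_t) => [x|x|h x Hh].
- by rewrite /phi; case: pickP.
- case: (fP x) => [[y ->]|f'x].
    rewrite phi_f (@eq_filter _ _ (pred1 y)) => [|y' /=]; last exact: inj_eq.
    by rewrite filter_pred1_uniq ?enum_uniq ?mem_enum.
  rewrite phi_f' // (@eq_filter _ _ pred0) ?filter_pred0 // => y.
  by rewrite (negPf (f'x y)).
case: (fP x) => [[y ->]|f'x].
  by rewrite -f_eq // !phi_f /= lab_code; apply: teq_refl.
rewrite !phi_f' //= ?fix_s0; first exact: teq_refl.
(* A preimage [y] of [a h x] would give the preimage [b h^-1 y] of [x]. *)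
move=> y; apply: contra (f'x (b h^-1 y)) => /eqP f_y.
by rewrite f_eq ?groupV // f_y (hactK aP).
Qed.

(** A copy of [u], with labels paired with [x], is grafted onto each leaf [x] of [t]. *)
Lemma adm_tree_prod H X Y (a : gT -> X -> X) (b : gT -> Y -> Y) t u :
  adm_tree H a t -> adm_tree H b u -> exists v, adm_tree H (prod_act a b) v.
Proof.
move=> adm_t [wf_u lab_u fix_u].
apply: (adm_tree_graft (phi := fun x => relabel (lab (pair x)) u) (pi := fst) adm_t).
- by move=> x; apply: wf_relabel.
- move=> x; apply: leaves_relabel_lab => // [y y' [] //|[x' y] /=].
  by apply/eqP/codomP => [->|[y' [-> _]]] //; exists y.
move=> h x Hh; rewrite gact_relabel // relabel_labM ?labelled_gact //.
rewrite (@eq_relabel_lab _ _ _ (pair (a h x) \o b h)) ?labelled_gact //.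
rewrite -(@relabel_labM _ _ _ _ _ (h *: u)) ?labelled_gact //.
exact/tequiv_relabel/fix_u.
Qed.

(** The outer tree has two leaves permuted trivially; [u] goes onto [true] and [v] onto [false]. *)
Lemma adm_tree_sum H X Y (a : gT -> X -> X) (b : gT -> Y -> Y) t u v :
  adm_tree H (fun _ (i : bool) => i) t ->
  adm_tree H a u -> adm_tree H b v -> exists w, adm_tree H (sum_act a b) w.
Proof.
move=> adm_t [wf_u lab_u fix_u] [wf_v lab_v fix_v].
pose phi (i : bool) := if i then relabel (lab (@inl X Y)) u else relabel (lab (@inr X Y)) v.
pose pi (z : X + Y) := if z is inl _ then true else false.
apply: (adm_tree_graft (phi := phi) (pi := pi) adm_t) => [[]|[]|h [] Hh].
- exact: wf_relabel.
- exact: wf_relabel.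
- apply: leaves_relabel_lab => // [x x' [] //|[x|y]] /=.
    by rewrite codom_f.
  by apply/esym/negbTE/codomP => -[].
- apply: leaves_relabel_lab => // [x x' [] //|[x|y]] /=.
    by apply/esym/negbTE/codomP => -[].
  by rewrite codom_f.
- rewrite gact_relabel // relabel_labM ?labelled_gact //.
  rewrite (@eq_relabel_lab _ _ _ (@inl X Y \o a h)) ?labelled_gact //.
  rewrite -(@relabel_labM _ _ _ _ _ (h *: u)) ?labelled_gact //.
  exact/tequiv_relabel/fix_u.
rewrite gact_relabel // relabel_labM ?labelled_gact //.
rewrite (@eq_relabel_lab _ _ _ (@inr X Y \o b h)) ?labelled_gact //.
rewrite -(@relabel_labM _ _ _ _ _ (h *: v)) ?labelled_gact //.
exact/tequiv_relabel/fix_v.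
Qed.

(** Translating a point by [g^-1] conjugates its stabilizer. *)
Lemma adm_tree_conj H X (a : gT -> X -> X) g t :
  adm_tree H a t -> adm_tree (H :^ g)%G (fun x => a (x ^ g^-1)) (g^-1 *: t).
Proof.
move=> [wf_t lab_t fix_t]; split=> [||h]; first exact: wf_gact.
  by rewrite labelled_gact.
rewrite mem_conjg => Hh.
have def_h: h * g^-1 = g^-1 * h ^ g^-1 by rewrite conjgE invgK mulKg.
rewrite -(gact_treeM HS) def_h (gact_treeM HS) -gact_relabel //.
exact/tequiv_gact/fix_t.
Qed.

(** Choose coset representatives [r z] and graft the translate of [u] by [r z] onto the leaf [z].
    Since [h * r z] equals [r (c h z) * k] with [k] in [K], acting by [h] permutes these translates
    up to [k], which [u] absorbs. *)
Lemma adm_tree_induced H K Z (c : gT -> Z -> Z) X (a : gT -> X -> X)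
    Y (b : gT -> Y -> Y) t u :
  K \subset H -> hset_ok H c -> hset_ok K a -> hset_ok H b ->
  is_coset_space H K c -> is_induced H K a b ->
  adm_tree H c t -> adm_tree K a u -> exists v, adm_tree H b v.
Proof.
move=> /subsetP KH cP aP bP [z0 [z0_gen z0_stab]] [j [j_eq [j_gen j_inj]]].
move=> adm_t [wf_u lab_u fix_u].
have [r rP]: exists r : Z -> gT, forall z, r z \in H /\ z = c (r z) z0.
  apply: (fin_all_exists (P := fun z h => h \in H /\ z = c h z0)) => z.
  by have [h Hh ->] := z0_gen z; exists h.
have [pi piP]: exists pi : Y -> Z,
    forall y, exists h x, [/\ h \in H, y = b h (j x) & pi y = c h z0].
  apply: (fin_all_exists
    (P := fun y z => exists h x, [/\ h \in H, y = b h (j x) & z = c h z0])) => y.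
  by have [h [x [Hh ->]]] := j_gen y; exists (c h z0), h, x.
have r_fact h z: h \in H -> c h z0 = z -> exists2 k, k \in K & h = r z * k.
  move=> Hh def_z; have [Hr def_r] := rP z; exists ((r z)^-1 * h).
    apply/z0_stab; rewrite ?groupM ?groupV // (hactM cP) ?groupV // def_z.
    exact: canLR (hactK cP Hr) def_r.
  by rewrite mulKVg.
pose phi z := relabel (lab (fun x => b (r z) (j x))) (r z *: u).
apply: (adm_tree_graft (phi := phi) (pi := pi) adm_t) => [z|z|h z Hh].
- exact/wf_relabel/wf_gact.
- have [Hr def_z] := rP z.
  apply: leaves_relabel_lab => [|x x'|y]; first by rewrite labelled_gact.
    case/(j_inj _ _ _ _ Hr Hr)=> k _ [/eqP]; rewrite -{1}[r z]mulg1.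
    by rewrite (inj_eq (mulgI _)) => /eqP <- ->; rewrite (hact1 aP).
  (* The fibre of [pi] over [z] is the translate by [r z] of the image of [j]: representatives of
     the same point of [Z] differ by an element of [K], which fixes [z0]. *)
  have [h [x [Hh def_y def_pi]]] := piP y; apply/eqP/codomP => [pi_y|[x' def_y']].
    have [|k Kk def_h] := r_fact h z Hh; first by rewrite -def_pi.
    by exists (a k x); rewrite /= j_eq // -(hactM bP _ Hr (KH k Kk)) -def_h.
  have [k Kk [def_r _]] := (j_inj _ _ _ _ Hr Hh).1 (etrans (esym def_y') def_y).
  rewrite def_pi [RHS]def_z def_r (hactM cP _ Hh (KH k Kk)); congr (c h _).
  exact/esym/(z0_stab k (KH k Kk)).
have [[Hr def_z] [Hr' _]] := (rP z, rP (c h z)).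
have [||k Kk def_k] := r_fact (h * r z) (c h z); first exact: groupM.
  by rewrite (hactM cP) // -def_z.
rewrite /phi gact_relabel // relabel_labM ?labelled_gact // -(gact_treeM HS) //.
rewrite def_k (gact_treeM HS) //.
rewrite (@eq_relabel_lab _ _ _ ((fun x => b (r (c h z)) (j x)) \o a k)) ?labelled_gact //.
  rewrite -(@relabel_labM _ _ _ _ _ (r _ *: _)) ?labelled_gact // -[in X in X ~~ _]gact_relabel //.
  exact/tequiv_relabel/tequiv_gact/fix_u.
by move=> x /=; rewrite j_eq // -(hactM bP _ Hh Hr) -(hactM bP _ Hr' (KH k Kk)) def_k.
Qed.

Lemma adm_tree_trivial H X t :
  wf_tree t -> labelled X t -> (forall g, g *: t = t) ->
  adm_tree H (fun _ (x : X) => x) t.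
Proof.
move=> wf_t lab_t fix_t; split=> // h _.
by rewrite fix_t relabel_lab_id //; apply: teq_refl.
Qed.

(** Combs of the fixed binary vertex, ending in the fixed nullary one, are fixed strictly and not
    only up to equivalence. *)
Lemma FS_fixed n :
  (exists s : S 0, forall g : gT, actS 0 g 1 s = s) ->
  (exists s : S 2, forall g : gT, actS 2 g 1 s = s) ->
  exists t, inF n t /\ forall g, g *: t = t.
Proof.
move=> [s0 fix_s0] [s2 fix_s2]; elim: n => [|n [t [[wf_t lv_t] fix_t]]].
  by exists (Node 0 s0 [::]); split=> // g /=; rewrite fix_s0.
exists (Node 2 s2 [:: t; Leaf n]); split=> [|g] /=; last by rewrite fix_s2 fix_t.
split; first by rewrite /= wf_t.
by rewrite -[n.+1]addn1 iotaD /= add0n perm_cat.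
Qed.

(** An [hclass] also ranges over maps that are not actions, so the class carries [hset_ok H a] as a
    premise, which makes [adm_FSP] applicable. *)
Lemma adm_FS_indexing :
  (exists s : S 0, forall g : gT, actS 0 g 1 s = s) ->
  (exists s : S 2, forall g : gT, actS 2 g 1 s = s) ->
  is_indexing_system (fun H X a => hset_ok H a -> adm_FS actS H a).
Proof.
move=> H0 H2.
have triv H X: exists t, adm_tree H (fun _ (x : X) => x) t.
  have [t [[wf_t lv_t] fix_t]] := FS_fixed #|X| H0 H2.
  by exists t; apply: adm_tree_trivial; rewrite // /labelled (permPl lv_t) perm_codes.
have sub H X Y (a : gT -> X -> X) (b : gT -> Y -> Y) (f : Y -> X) :
     hset_ok H a -> hset_ok H b -> injective f ->
     (forall h y, h \in H -> f (b h y) = a h (f y)) ->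
     (hset_ok H a -> adm_FS actS H a) -> hset_ok H b -> adm_FS actS H b.
  move=> aP bP f_inj f_eq adm_a _; have /(adm_FSP aP)[t adm_t] := adm_a aP.
  exact/(adm_FSP bP)/(adm_tree_sub H0 aP bP f_inj f_eq adm_t).
repeat split.
- by move=> H X aP; apply/(adm_FSP aP)/triv.
- by move=> H X Y a b f aP bP /bij_inj; apply: sub.
- move=> H K X a /subsetP KH aP adm_a aKP; have [t [inF_t fix_t]] := adm_a aP.
  by exists t; split=> // h /KH; apply: fix_t.
- move=> H X a g aP adm_a agP; have /(adm_FSP aP)[t adm_t] := adm_a aP.
  by apply/(adm_FSP agP); exists (g^-1 *: t); apply: adm_tree_conj.
- exact: sub.
- move=> H X Y a b aP bP adm_a adm_b abP; apply/(adm_FSP abP).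
  have [[t adm_t] /(adm_FSP aP)[u adm_u]] := (triv H bool, adm_a aP).
  by have /(adm_FSP bP)[v adm_v] := adm_b bP; apply: adm_tree_sum adm_t adm_u adm_v.
- move=> H X Y a b aP bP adm_a adm_b abP; apply/(adm_FSP abP).
  have /(adm_FSP aP)[t adm_t] := adm_a aP.
  by have /(adm_FSP bP)[u adm_u] := adm_b bP; apply: adm_tree_prod adm_t adm_u.
move=> H K Z c X a Y b KH cP aP bP cosP adm_c adm_a indP _; apply/(adm_FSP bP).
have /(adm_FSP cP)[t adm_t] := adm_c cP; have /(adm_FSP aP)[u adm_u] := adm_a aP.
exact: adm_tree_induced KH cP aP bP cosP indP adm_t adm_u.
Qed.

(** The corolla on a fixed [s] is fixed: relabelling its leaves permutes its inputs, and
    [teq_vertex] moves that permutation into the decoration. *)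
Lemma adm_symseq_FS H X (a : gT -> X -> X) : adm_symseq actS H a -> adm_FS actS H a.
Proof.
case=> s fix_s; exists (Node #|X| s (map Leaf (iota 0 #|X|))); split; [split|].
- apply: wf_NodeP => [|i]; rewrite size_map size_iota // => lt_i.
  by rewrite (nth_map 0) ?size_iota.
- rewrite /= -map_comp.
  by have ->: flatten (map (@leaves S \o Leaf) (iota 0 #|X|)) = iota 0 #|X|
    by elim: (iota _ _) => //= i l ->.
move=> h Hh; set sigma := sigma_of a h; rewrite /sact /= -!map_comp.
have ->: map (relabel (permf sigma) \o (Defs.gact actS h \o Leaf)) (iota 0 #|X|)
       = permute sigma (map Leaf (iota 0 #|X|)).
  rewrite -{1}val_enum_ord -map_comp; apply: eq_map => i /=.
  by rewrite (nth_map 0) ?size_iota // nth_iota // /permf valK.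
apply: teq_trans (teq_sym (teq_vertex actS _ _ _)) _.
  by rewrite size_map size_iota.
rewrite -(actSM HS) mul1g mul1g (fix_s h Hh); exact: teq_refl.
Qed.

End Admissible.

Lemma uniq_flatten_block (T : eqType) (ss : seq (seq T)) i :
  uniq (flatten ss) -> uniq (nth [::] ss i).
Proof. by elim: ss i => [|s ss IHss] [|i] //=; rewrite cat_uniq => /and3P[] // _ _ /IHss. Qed.

(** * Stable subsets and stabilizers *)

Section Restriction.
Variables (gT : finGroupType) (H : {group gT}) (X : finType) (a : gT -> X -> X).
Hypothesis aP : hset_ok H a.

(** The default of [insubd] only matters where [a h] leaves [P], which does not happen for stable
    [P]. *)
Definition sub_act (P : pred X) h (u : {x | P x}) : {x | P x} :=
  insubd u (a h (val u)).

Lemma val_sub_act (P : pred X) h (u : {x | P x}) :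
  P (a h (val u)) -> val (sub_act h u) = a h (val u).
Proof. exact: insubdK. Qed.

Lemma hset_ok_sub (K : {group gT}) (P : pred X) : K \subset H ->
  (forall h x, h \in K -> P x -> P (a h x)) -> hset_ok K (@sub_act P).
Proof.
move=> /subsetP KH Pa; split=> [u|h h' Kh Kh' u].
  by apply: val_inj; rewrite val_sub_act (hact1 aP) ?(valP u).
have Pu := valP u; apply: val_inj.
have Phu: P (a h' (val u)) by apply: Pa.
by rewrite !val_sub_act ?(hactM aP) ?KH ?groupM // ?Pa // -(hactM aP) ?KH ?Pa ?groupM.
Qed.

Definition hstab x := [set h in H | a h x == x].

Lemma hstab_group_set x : group_set (hstab x).
Proof.
apply/group_setP; split=> [|h h']; first by rewrite inE group1 (hact1 aP) eqxx.
rewrite !inE => /andP[Hh /eqP ah] /andP[Hh' /eqP ah'].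
by rewrite groupM // (hactM aP) // ah' ah eqxx.
Qed.

Definition hstab_group x : {group gT} := Group (hstab_group_set x).

End Restriction.

(** * Unions and equivariant fibrations in an arbitrary indexing system *)

Section IndexingSystem.
Variables (gT : finGroupType) (I : hclass gT).
Hypothesis HI : is_indexing_system I.
Implicit Types (H K : {group gT}) (X Y Z : finType).

Lemma indexing_triv H X : I H (fun _ (x : X) => x).
Proof. by case: HI. Qed.

Lemma indexing_sub H X Y (a : gT -> X -> X) (b : gT -> Y -> Y) (f : Y -> X) :
  hset_ok H a -> hset_ok H b -> injective f ->
  (forall h y, h \in H -> f (b h y) = a h (f y)) -> I H a -> I H b.
Proof. by case: HI => _ [_ [_ [_ [sub _]]]]; apply: sub. Qed.

Lemma indexing_sum H X Y (a : gT -> X -> X) (b : gT -> Y -> Y) :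
  hset_ok H a -> hset_ok H b -> I H a -> I H b -> I H (sum_act a b).
Proof. by case: HI => _ [_ [_ [_ [_ [sum _]]]]]; apply: sum. Qed.

Lemma indexing_induced H K Z (c : gT -> Z -> Z) X (a : gT -> X -> X)
    Y (b : gT -> Y -> Y) :
  K \subset H -> hset_ok H c -> hset_ok K a -> hset_ok H b ->
  is_coset_space H K c -> I H c -> I K a -> is_induced H K a b -> I H b.
Proof. by case: HI => _ [_ [_ [_ [_ [_ [_ ind]]]]]]; apply: ind. Qed.

Lemma hset_ok_sum H X Y (a : gT -> X -> X) (b : gT -> Y -> Y) :
  hset_ok H a -> hset_ok H b -> hset_ok H (sum_act a b).
Proof.
move=> [a1 aM] [b1 bM]; split=> [[x|y]|h h' Hh Hh' [x|y]] /=.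
- by rewrite a1.
- by rewrite b1.
- by rewrite aM.
by rewrite bM.
Qed.

Lemma hset_ok_triv H X : hset_ok H (fun _ (x : X) => x).
Proof. by []. Qed.

(** [P] and [Q] may overlap, so the union is embedded into the disjoint sum, with the left summand
    preferred. The preference is equivariant because [P] and its complement are both stable. *)
Lemma indexing_union H X (a : gT -> X -> X) (P Q : pred X) :
  hset_ok H a ->
  (forall h x, h \in H -> P x -> P (a h x)) ->
  (forall h x, h \in H -> Q x -> Q (a h x)) ->
  I H (sub_act a (P := P)) -> I H (sub_act a (P := Q)) ->
  I H (sub_act a (P := fun x => P x || Q x)).
Proof.
move=> aP Pa Qa IP IQ.
have PQa h x: h \in H -> P x || Q x -> P (a h x) || Q (a h x).
  by move=> Hh /orP[/(Pa h _ Hh)|/(Qa h _ Hh)] /= ->; rewrite ?orbT.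
have [PP QQ] := (hset_ok_sub aP (subxx H) Pa, hset_ok_sub aP (subxx H) Qa).
have fP (u : {x | P x || Q x}) :
    exists v : {x | P x} + {x | Q x},
      match v with inl w => val w | inr w => val w end = val u
      /\ (P (val u) -> if v is inl _ then true else false).
  case PQu: (P (val u)); first by exists (inl (exist _ (val u) PQu)).
  have Qu: Q (val u) by have := valP u; rewrite /= PQu.
  by exists (inr (exist _ (val u) Qu)).
have [f fE] := fin_all_exists fP.
apply: (indexing_sub (f := f) (hset_ok_sum PP QQ)) (indexing_sum PP QQ IP IQ).
- exact: (hset_ok_sub aP (subxx H) PQa).
- by move=> u v fuv; apply: val_inj; have [<- _] := fE u; have [<- _] := fE v; rewrite fuv.
move=> h u Hh; have [] := fE (sub_act a h u); have [] := fE u.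
rewrite val_sub_act; last exact: PQa (valP u).
case: (f u) => [[x Px]|[x Qx]] /= <- Pu; case: (f _) => [[y Py]|[y Qy]] /= def_y.
- by move=> _; congr inl; apply: val_inj; rewrite val_sub_act /= ?Pa.
- by move=> /(_ (Pa h x Hh Px)).
(* If [a h x] lies in [P], so does [x], by acting with [h^-1]. *)
- suff /Pu: P x by [].
  by rewrite -(hactK aP Hh x) -def_y Pa ?groupV.
by move=> _; congr inr; apply: val_inj; rewrite val_sub_act /= ?Qa.
Qed.

Section Fibration.
Variables (H : {group gT}) (X Z : finType) (a : gT -> X -> X) (c : gT -> Z -> Z).
Variable pi : X -> Z.
Hypotheses (aP : hset_ok H a) (cP : hset_ok H c).
Hypothesis pi_eq : forall h x, h \in H -> pi (a h x) = c h (pi x).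
Hypothesis Ic : I H c.

Definition horbit z := [pred z' | [exists h in H, c h z == z']].

Lemma horbit_act z h z' : h \in H -> horbit z z' -> horbit z (c h z').
Proof.
move=> Hh /existsP[h' /andP[Hh' /eqP <-]].
by apply/existsP; exists (h * h'); rewrite groupM // (hactM cP) ?eqxx.
Qed.

Lemma horbit_refl z : horbit z z.
Proof. by apply/existsP; exists 1; rewrite group1 (hact1 cP) eqxx. Qed.

Lemma fibre_stab z h x : h \in hstab_group cP z -> pi x == z -> pi (a h x) == z.
Proof. by rewrite inE => /andP[Hh /eqP cz] /eqP pi_x; rewrite pi_eq ?pi_x ?cz. Qed.

Lemma preim_act z h x : h \in H -> horbit z (pi x) -> horbit z (pi (a h x)).
Proof. by move=> Hh; rewrite pi_eq //; apply: horbit_act. Qed.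

Lemma hstab_sub z : hstab_group cP z \subset H.
Proof. by apply/subsetP => h; rewrite inE => /andP[]. Qed.

(** The orbit of [z] is a subobject of [Z] isomorphic to the cosets of the stabilizer, and its
    preimage is induced from the fibre over [z]; self-induction applies. *)
Lemma indexing_preim_horbit z :
  I (hstab_group cP z) (sub_act a (P := fun x => pi x == z)) ->
  I H (sub_act a (P := fun x => horbit z (pi x))).
Proof.
move=> Ifib.
have orbP := hset_ok_sub cP (subxx H) (@horbit_act z).
have Iorb: I H (sub_act c (P := horbit z)).
  apply: (indexing_sub (f := val) cP orbP val_inj) Ic => h y Hh.
  exact: val_sub_act (horbit_act Hh (valP y)).
have fibP := hset_ok_sub aP (hstab_sub z) (@fibre_stab z).
have preP := hset_ok_sub aP (subxx H) (@preim_act z).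
have fibE h (u : {x | pi x == z}) : h \in hstab_group cP z ->
    val (sub_act a h u) = a h (val u).
  by move=> Kh; apply: val_sub_act; apply: (fibre_stab Kh (valP u)).
have preE h (u : {x | horbit z (pi x)}) : h \in H -> val (sub_act a h u) = a h (val u).
  by move=> Hh; apply: val_sub_act; apply: (preim_act Hh (valP u)).
apply: (indexing_induced (hstab_sub z) orbP fibP preP) Iorb Ifib _.
  pose z0 : {z' | horbit z z'} := exist _ z (horbit_refl z).
  have orbE h (y : {z' | horbit z z'}) : h \in H -> val (sub_act c h y) = c h (val y).
    by move=> Hh; apply: val_sub_act; apply: (horbit_act Hh (valP y)).
  exists z0; split=> [y|h Hh].
    have /existsP[h /andP[Hh /eqP ch]] := valP y.
    by exists h => //; apply: val_inj; rewrite orbE.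
  split=> [/(congr1 val)|]; first by rewrite orbE // inE Hh => /= ->; rewrite eqxx.
  by rewrite inE => /andP[_ /eqP ch]; apply: val_inj; rewrite orbE.
have in_orb (u : {x | pi x == z}) : horbit z (pi (val u)).
  by rewrite (eqP (valP u)); apply: horbit_refl.
exists (fun u => exist _ (val u) (in_orb u)); split; last split.
- move=> k u Kk; apply: val_inj => /=.
  by rewrite fibE // preE // (subsetP (hstab_sub z)).
- move=> y; have /existsP[h /andP[Hh /eqP ch]] := valP y.
  have fib_y: pi (a h^-1 (val y)) == z.
    by rewrite pi_eq ?groupV // -ch (hactK cP).
  exists h, (exist _ (a h^-1 (val y)) fib_y); split=> //; apply: val_inj.
  by rewrite preE //= (hactKV aP).
move=> h h' u u' Hh Hh'; split=> [/(congr1 val)|[k Kk [-> ->]]].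
  rewrite !preE //= => def_u.
  have def_u': val u' = a (h'^-1 * h) (val u).
    by rewrite (hactM aP) ?groupV // def_u (hactK aP).
  (* This element carries one point of the fibre over [z] to another, so it fixes [z]. *)
  have Kk: h'^-1 * h \in hstab_group cP z.
    rewrite inE groupM ?groupV //= -{1}(eqP (valP u)) -pi_eq ?groupM ?groupV //.
    by rewrite -def_u' (eqP (valP u')).
  exists (h'^-1 * h) => //; split; first by rewrite mulKVg.
  by apply: val_inj; rewrite fibE.
have Hk := subsetP (hstab_sub z) k Kk.
by apply: val_inj; rewrite !preE ?groupM //= fibE // (hactM aP).
Qed.

(* [X] embeds into a finite union of preimages of orbits, each induced from
   the fibre over a point of the orbit. *)
Lemma indexing_fibration :
  (forall z, I (hstab_group cP z) (sub_act a (P := fun x => pi x == z))) ->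
  I H a.
Proof.
move=> Ifib; pose P (zs : seq Z) x := has (fun z => horbit z (pi x)) zs.
have Pa zs h x: h \in H -> P zs x -> P zs (a h x).
  by move=> Hh; apply: sub_has => z; apply: preim_act.
have IP zs: I H (sub_act a (P := P zs)).
  elim: zs => [|z zs IHzs].
    (* No point lies over the empty list, so equivariance is vacuous. *)
    apply: (indexing_sub (f := id) (@hset_ok_triv _ _)) (indexing_triv _ _) => //.
      exact: (hset_ok_sub aP (subxx H) (@Pa [::])).
    by move=> h [].
  apply: indexing_union aP _ (Pa zs) (indexing_preim_horbit (Ifib z)) IHzs.
  exact: preim_act.
have allP x: P (enum Z) x.
  by apply/hasP; exists (pi x); rewrite ?mem_enum ?horbit_refl.
apply: (indexing_sub (f := fun x => exist _ x (allP x)) _ aP) (IP (enum Z)).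
- exact: (hset_ok_sub aP (subxx H) (@Pa _)).
- by move=> x y [].
by move=> h x Hh; apply: val_inj; rewrite val_sub_act /= ?allP.
Qed.

End Fibration.
End IndexingSystem.

(** * Every indexing system containing the admissible sets of [S] contains those of the free
    operad *)

Section Converse.
Variables (gT : finGroupType) (S : nat -> Type)
          (actS : forall n, gT -> 'S_n -> S n -> S n).
Arguments actS : clear implicits.
Hypothesis HS : is_symseq actS.
Hypothesis Hfree : forall n, sigma_free (actS n).
Variable I : hclass gT.
Hypothesis HI : is_indexing_system I.
Hypothesis adm_I : forall (H : {group gT}) (X : finType) (a : gT -> X -> X),
  adm_symseq actS H a -> I H a.
Implicit Types (t u : tree S) (H K : {group gT}) (X Y Z : finType).

Local Notation nth_tree := (nth (Leaf (S:=S) 0)).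
Local Notation "t ~~ u" := (tequiv actS t u) (at level 70).
Local Notation "g *: t" := (Defs.gact actS g t).

(** [adm_symseq] asks for a point of level [#|'I_k|], which equals [k] only up to a proof, while a
    vertex carries a point of level [k]. *)
Lemma symseq_transport k m (e : m = k) (s : S k) : exists s' : S m,
  forall h (sigma : 'S_k) (tau : 'S_m), (forall i, cast_ord e (tau i) = sigma (cast_ord e i)) ->
  actS k h sigma s = s -> actS m h tau s' = s'.
Proof.
case: k / e s => s; exists s => h sigma tau eq_tau fix_s.
have -> // : tau = sigma.
by apply/permP => i; have := eq_tau i; rewrite !cast_ord_id.
Qed.

Lemma adm_symseq_ord H k (c : gT -> 'I_k -> 'I_k) (sg : gT -> 'S_k) (s : S k) :
  hset_ok H c -> (forall h, h \in H -> c h =1 sg h /\ actS k h (sg h) s = s) ->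
  adm_symseq actS H c.
Proof.
move=> cP sgP; have [s' s'P] := symseq_transport (card_ord k) s.
exists s' => h Hh; have [c_sg fix_s] := sgP h Hh.
apply: s'P fix_s => i; rewrite (sigma_ofE cP) // -enum_val_ord enum_rankK.
by rewrite c_sg enum_val_ord.
Qed.

(** The form is dictated by the induction: a subtree keeps labels of the ambient tree, so [X] is
    embedded by any injection [e], and [f] is constrained only on the labels that occur. *)
Lemma fixed_tree_indexing t H X (a : gT -> X -> X) (e : X -> nat) :
  hset_ok H a -> wf_tree t -> uniq (leaves t) -> injective e ->
  (forall n, n \in leaves t <-> exists x, n = e x) ->
  (forall h f, h \in H -> (forall x, f (e x) = e (a h x)) -> relabel f (h *: t) ~~ t) ->
  I H a.
Proof.
elim/tree_nth_ind: t H X a e => [i|k s ts IHt] H X a e aP wf_t uniq_t e_inj lv_t fix_t.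
  (* On a single leaf, [X] has one point and the action is trivial. *)
  have e_i x: e x = i by apply/eqP; rewrite -mem_seq1; apply/lv_t; exists x.
  apply: (indexing_sub HI (f := id) (@hset_ok_triv _ _ _) aP) (indexing_triv HI _ _) => //.
  by move=> h x _; apply: e_inj; rewrite !e_i.
have /eqP sz: size ts == k by case/andP: wf_t.
have nth_lv (i : 'I_k) : nth [::] (map (@leaves S) ts) i = leaves (nth_tree ts i).
  by rewrite (nth_map (Leaf 0)) ?sz.
have lab_ex h: exists f : nat -> nat, forall x, f (e x) = e (a h x).
  exists (fun n => if [pick x | e x == n] is Some x then e (a h x) else n) => x.
  by case: pickP => [y /eqP/e_inj -> //|/(_ x)]; rewrite eqxx.
have lv_sub (i : 'I_k) n : n \in leaves (nth_tree ts i) -> exists x, n = e x.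
  by move=> n_i; apply/lv_t/(leaves_nth _ n_i); rewrite sz.
(* [sg h] is the root permutation obtained by inverting the equivalence for [h]. *)
have [sg sgP]: exists sg : gT -> 'S_k, forall h, h \in H ->
    actS k h (sg h) s = s /\ forall (i : 'I_k) f, (forall x, f (e x) = e (a h x)) ->
      relabel f (h *: nth_tree ts i) ~~ nth_tree ts (sg h i).
  apply: (fin_all_exists (P := fun h sg => h \in H -> actS k h sg s = s /\
    forall (i : 'I_k) f, (forall x, f (e x) = e (a h x)) ->
      relabel f (h *: nth_tree ts i) ~~ nth_tree ts (sg i))) => h.
  have [Hh|] := boolP (h \in H); last by exists 1.
  have [f fE] := lab_ex h.
  have [|sigma [def_s tsts]] := tequiv_Node HS _ (fix_t h f Hh fE).
    exact: wf_relabel (wf_gact actS h wf_t).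
  exists sigma => _; split=> [|i f' f'E].
    by rewrite {2}def_s -(actSM HS) mul1g mul1g.
  have tsts_i: relabel f (h *: nth_tree ts i) ~~ nth_tree ts (sigma i).
    by have := tsts i; rewrite !(nth_map (Leaf 0)) ?size_map ?sz.
  rewrite (@eq_relabel _ f' f) // => n; rewrite leaves_gact => /lv_sub[x ->].
  by rewrite fE f'E.
pose c h := sg h : 'I_k -> 'I_k.
(* Multiplicativity comes from uniqueness: [sg (h * h')] and the composite fix [s] together with the
   same group element. *)
have cP: hset_ok H c.
  split=> [i|h h' Hh Hh' i].
    have [fix_s _] := sgP 1 (group1 H).
    by rewrite /c (actS_inj_perm HS Hfree fix_s (actS1 HS s)) perm1.
  have [[fix_h _] [fix_h' _]] := (sgP h Hh, sgP h' Hh').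
  have [fix_hh' _] := sgP (h * h') (groupM Hh Hh').
  have fix_prod: actS k (h * h') (sg h' * sg h) s = s by rewrite (actSM HS) fix_h'.
  by rewrite /c (actS_inj_perm HS Hfree fix_hh' fix_prod) permM.
have Ic: I H c.
  apply: adm_I; apply: (adm_symseq_ord (sg := sg) (s := s) cP) => h Hh; split=> //.
  by case: (sgP h Hh).
have [pi piP]: exists pi : X -> 'I_k, forall x, e x \in leaves (nth_tree ts (pi x)).
  apply: (fin_all_exists (P := fun x (i : 'I_k) => e x \in leaves (nth_tree ts i))) => x.
  have /mem_leaves_nth[i]: e x \in leaves (Node k s ts) by apply/lv_t; exists x.
  by rewrite sz => lt_i x_i; exists (Ordinal lt_i).
have pi_uniq x (i : 'I_k) : e x \in leaves (nth_tree ts i) -> pi x = i.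
  move=> x_i; apply/val_inj/(uniq_flatten_nth (x := e x) uniq_t); rewrite nth_lv //.
have pi_eq h x: h \in H -> pi (a h x) = c h (pi x).
  move=> Hh; have [f fE] := lab_ex h; have [_ tsts] := sgP h Hh.
  (* The label of [a h x] occurs in the relabelled translate of child [pi x], which is equivalent to
     child [c h (pi x)]. *)
  apply: pi_uniq; rewrite -(perm_mem (tequiv_leaves (tsts (pi x) f fE))).
  by rewrite leaves_relabel leaves_gact -fE map_f.
apply: (indexing_fibration HI aP pi_eq Ic) => i.
have fibP := hset_ok_sub aP (hstab_sub cP i) (@fibre_stab _ _ _ _ _ _ _ cP pi_eq i).
have lt_i: i < size ts by rewrite sz.
apply: (IHt i lt_i _ _ _ (fun x => e (val x)) fibP) => [|||n|h f Kh fE].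
- exact: wf_nth wf_t lt_i.
- by rewrite -nth_lv; apply: uniq_flatten_block.
- by move=> u v /e_inj/val_inj.
- split=> [n_i|[u ->]]; last by have := piP (val u); rewrite (eqP (valP u)).
  have [x def_n] := lv_sub i n n_i.
  have pi_x: pi x == i by apply/eqP/pi_uniq; rewrite -def_n.
  by exists (exist _ x pi_x).
(* Since [h] fixes [i], child [i] is matched with itself. The given [f] is known only on the fibre,
   so it is compared there with an extension [f0] of the whole action. *)
have [f0 f0E] := lab_ex h; move: (Kh); rewrite inE => /andP[Hh /eqP ci].
have [_ /(_ i f0 f0E)] := sgP h Hh; rewrite -/(c h i) ci.
rewrite (@eq_relabel _ f0 f) // => n; rewrite leaves_gact => n_i.
have [x def_n] := lv_sub i n n_i.
have pi_x: pi x == i by apply/eqP/pi_uniq; rewrite -def_n.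
have := fE (exist _ x pi_x); rewrite val_sub_act /= -?def_n => [->|]; first by rewrite def_n f0E.
exact: (fibre_stab pi_eq Kh pi_x).
Qed.

Lemma adm_FS_sub_indexing H X (a : gT -> X -> X) :
  hset_ok H a -> adm_FS actS H a -> I H a.
Proof.
move=> aP /(adm_FSP actS aP)[t [wf_t lab_t fix_t]].
apply: (fixed_tree_indexing aP wf_t _ (@code_inj X)) => [|n|h f Hh fE].
- by rewrite (perm_uniq lab_t) (map_inj_uniq (@code_inj X)) enum_uniq.
- split=> [/(labelled_code lab_t) //|[x ->]].
  by rewrite (perm_mem lab_t) map_f ?mem_enum.
rewrite (@eq_relabel _ f (lab (a h))); first exact: fix_t.
by move=> n; rewrite leaves_gact => /(labelled_code lab_t)[x ->]; rewrite lab_code.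
Qed.

End Converse.

Theorem theorem4p6 (gT : finGroupType) (S : nat -> Type)
  (actS : forall n, gT -> 'S_n -> S n -> S n)
  (HS : is_symseq actS)
  (Hfree : forall n, sigma_free (actS n))
  (H0 : exists s : S 0, forall g : gT, actS 0 g 1 s = s)
  (H2 : exists s : S 2, forall g : gT, actS 2 g 1 s = s) :
  FS_sigma_free actS /\
  (forall n, FS_G_fixed_nonempty actS n) /\
  (forall (H : {group gT}) (X : finType) (a : gT -> X -> X), hset_ok H a ->
     (adm_FS actS H a <-> gen_indexing (adm_symseq actS) H a)).
Proof.
split; first exact: FS_sigma_freeP HS Hfree.
split=> [n|H X a aP].
  have [t [inF_t fix_t]] := FS_fixed n H0 H2.
  by exists t; split=> // g; rewrite fix_t; apply: teq_refl.
split=> [adm_a I HI adm_I|gen_a].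
  exact: (adm_FS_sub_indexing HS Hfree HI adm_I aP adm_a).
(* Minimality of the generated system is applied to the admissible sets of the free operad. *)
apply: gen_a (adm_FS_indexing HS H0 H2) _ aP => H' X' a' adm_a' _.
exact: (adm_symseq_FS HS adm_a').
Qed.
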